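(* Let $G$ be a niche-realizable graph. Then each component of the condensation $G^*$ of $G$ is a complete multipartite graph whose partite sets have size at most two, and among these partite sets there is at most one of size one.
   Context: All graphs are simple. A bipartite tournament is an orientation of a complete bipartite graph. The niche graph of a digraph $D$ is the graph with vertex set $V(D)$ in which distinct $u,v$ are adjacent iff there is a vertex $w$ with $(u,w),(v,w)\in A(D)$, or with $(w,u),(w,v)\in A(D)$. A graph is niche-realizable if it is the niche graph of some bipartite tournament. Two vertices of a graph are homogeneous if they have the same closed neighborhood; this is an equivalence relation, and its classes are called critical cliques. The condensation $G^*$ of $G$ is the graph obtained by identifying the vertices within each critical clique of $G$. *)

(* Defs.v *)
From Stdlib Require Export Relation_Operators.
From mathcomp Require Export all_boot.
From mathcomp Require Export boolp classical_sets functions cardinality.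

Set Implicit Arguments.
Unset Strict Implicit.
Unset Printing Implicit Defensive.

Global Open Scope classical_set_scope.
Global Open Scope card_scope.

(* Vertex sets are not assumed finite. *)
Record sgraph (V : Type) : Type := SGraph {
  adj :> V -> V -> Prop;
  adj_sym : forall u v, adj u v -> adj v u;
  adj_irrefl : forall u, ~ adj u u }.

Definition digraph (V : Type) : Type := V -> V -> Prop.

Definition orientation V (G : sgraph V) (D : digraph V) : Prop :=
  (forall u v, G u v <-> D u v \/ D v u) /\
  (forall u v, ~ (D u v /\ D v u)).

(* An empty partite set is allowed, so that edgeless graphs qualify. *)
Definition complete_bipartite V (G : sgraph V) : Prop :=
  exists X Y : set V,
    [/\ X `|` Y = setT, X `&` Y = set0 &
        forall u v, G u v <-> (X u /\ Y v) \/ (Y u /\ X v)].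

Definition bipartite_tournament V (D : digraph V) : Prop :=
  exists G : sgraph V, complete_bipartite G /\ orientation G D.

Definition niche_adj V (D : digraph V) (u v : V) : Prop :=
  u <> v /\ exists w, (D u w /\ D v w) \/ (D w u /\ D w v).

Lemma niche_adj_sym V (D : digraph V) u v :
  niche_adj D u v -> niche_adj D v u.
Proof.
by case=> uv [w [[]|[]] wu wv]; split; [exact: nesym|exists w; left|
  exact: nesym|exists w; right].
Qed.

Lemma niche_adj_irrefl V (D : digraph V) u : ~ niche_adj D u u.
Proof. by case. Qed.

Definition niche_graph V (D : digraph V) : sgraph V :=
  SGraph (@niche_adj_sym V D) (@niche_adj_irrefl V D).

Definition niche_realizable V (G : sgraph V) : Prop :=
  exists D : digraph V,
    bipartite_tournament D /\ forall u v, G u v <-> niche_graph D u v.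

Definition closed_nbhd V (G : sgraph V) (v : V) : set V :=
  [set u | u = v \/ G v u].

Definition homogeneous V (G : sgraph V) (u v : V) : Prop :=
  closed_nbhd G u = closed_nbhd G v.

Definition critical_cliques V (G : sgraph V) : set (set V) :=
  [set K | exists v, K = [set u | homogeneous G u v]].

(* Identifying the vertices of each class: the vertices of the quotient are
   the classes themselves, and the loops and multiple edges are discarded. *)
Definition condensation_adj V (G : sgraph V) (K L : critical_cliques G) :
    Prop :=
  K <> L /\ exists u v, [/\ val K u, val L v & G u v].

Lemma condensation_adj_sym V (G : sgraph V) (K L : critical_cliques G) :
  condensation_adj K L -> condensation_adj L K.
Proof.
case=> KL [u [v [Ku Lv uv]]]; split; first exact: nesym.
by exists v, u; split=> //; exact: adj_sym.
Qed.

Lemma condensation_adj_irrefl V (G : sgraph V) (K : critical_cliques G) :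
  ~ condensation_adj K K.
Proof. by case. Qed.

Definition condensation V (G : sgraph V) : sgraph (critical_cliques G) :=
  SGraph (@condensation_adj_sym V G) (@condensation_adj_irrefl V G).

Definition induced V (G : sgraph V) (C : set V) : sgraph C :=
  @SGraph C (fun u v => G (val u) (val v))
    (fun u v => @adj_sym V G (val u) (val v))
    (fun u => @adj_irrefl V G (val u)).

(* The vertex sets of the connected components of G; the component itself is
   the corresponding induced subgraph. *)
Definition components V (G : sgraph V) : set (set V) :=
  [set C | exists v, C = [set u | clos_refl_trans V G v u]].

(* P is the set of partite sets; partition requires them to be nonempty. *)
Definition complete_multipartite V (G : sgraph V) (P : set (set V)) : Prop :=
  partition P id [set: V] /\
  forall u v, G u v <-> ~ exists A, [/\ P A, A u & A v].

(* Main.v *)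
Require Import Defs.

(* If D is a bipartite tournament, two vertices u, v with a common neighbor in
   the underlying graph lie in the same part, and they are distinct and not
   niche-adjacent exactly when the out-neighborhood of u is the in-neighborhood
   of v and vice versa. Two vertices "opposite" to the same vertex are hence
   twins in D, so up to homogeneity a vertex has at most one non-neighbor in
   its component of the niche graph; and two vertices having no non-neighbor in
   their common component are homogeneous. *)

Section Cardinality.

Context {T : Type}.

(** [x] and [y] may coincide, so that one-element partite sets are covered too. *)
Lemma card_le_pair (A : set T) (x y : T) :
  A `<=` [set x; y] -> A #<= `I_2.
Proof.
move=> Axy; pose f n := if n == 0 then x else y.
apply: (card_le_trans _ (card_image_le f _)); apply: subset_card_le.
by move=> a /Axy[] ->; [exists 0|exists 1].
Qed.

Lemma card_eq1_inj (A : set T) (x y : T) :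
  A #= `I_1 -> A x -> A y -> x = y.
Proof.
move=> /card_set_bijP[f [fA finj _]] Ax Ay; apply: finj; rewrite ?inE //.
have f0 z : A z -> f z = 0.
  by move=> /fA /=; case: (f z).
by rewrite !f0.
Qed.

End Cardinality.

Section ComponentMultipartite.

Context {T : Type} (H : sgraph T).

Local Notation conn := (clos_refl_trans _ H).

Lemma conn_sym u v : conn u v -> conn v u.
Proof.
elim=> [x y xy|x|x y z _ yx _ zy]; first by apply: rt_step; exact: adj_sym.
- exact: rt_refl.
- exact: rt_trans zy yx.
Qed.

(** The partite sets are the classes of non-adjacency on [C]. The first hypothesis makes this
    relation transitive with classes of at most two elements; the second leaves room for only one
    singleton class. *)
Lemma component_multipartite (C : set T) :
  components H C ->
  (forall u v w, conn u v -> conn u w -> u <> v -> u <> w ->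
     ~ H u v -> ~ H u w -> v = w) ->
  (forall u v, H u v -> (forall w, conn u w -> w <> u -> H u w) ->
     (forall w, conn v w -> w <> v -> H v w) -> u = v) ->
  exists P : set (set C),
    [/\ complete_multipartite (induced H C) P,
        forall A, P A -> A #<= `I_2 &
        forall A B, P A -> P B -> A #= `I_1 -> B #= `I_1 -> A = B].
Proof.
move=> [r CE] uniq_nonadj uniq_univ.
have CP w : C w <-> conn r w by rewrite CE.
have Cconn (u v : C) : conn (val u) (val v).
  have /CP ru := set_valP u; have /CP rv := set_valP v.
  by apply: rt_trans rv; exact: conn_sym.
have connC (u : C) w : conn (val u) w -> {v : C | val v = w}.
  move=> uw; suff wC : w \in C by exists (exist _ w wC).
  have /CP ru := set_valP u.
  by rewrite inE; apply/CP; exact: rt_trans uw.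
pose nonadj (u v : C) := ~ H (val u) (val v).
have nonadj_refl u : nonadj u u by exact: adj_irrefl.
have nonadj_sym u v : nonadj u v -> nonadj v u.
  by move=> uv vu; apply: uv; exact: adj_sym.
have third u v w : nonadj u v -> nonadj u w -> [\/ u = v, u = w | v = w].
  move=> uv uw; have [->|uv'] := pselect (u = v); first exact: Or31.
  have [->|uw'] := pselect (u = w); first exact: Or32.
  apply: Or33; apply: val_inj; apply: (uniq_nonadj (val u)) => //.
  - by move/val_inj.
  - by move/val_inj.
(* By [third] at the middle vertex, two of the three vertices coincide. *)
have nonadj_trans u v w : nonadj u v -> nonadj v w -> nonadj u w.
  by move=> uv vw; have [<-|<-|->] := third v u w (nonadj_sym _ _ uv) vw.
have nonadj_eq u v : nonadj u v -> nonadj u = nonadj v :> set C.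
  move=> uv; apply/seteqP; split=> w /=; first exact/nonadj_trans/nonadj_sym.
  exact: nonadj_trans.
exists [set A | exists u, A = nonadj u]; split.
- split; [split|].
  + apply/seteqP; split=> // u _; exists (nonadj u) => //; first by exists u.
  + move=> _ _ [u ->] [v ->] [w [uw vw]].
    by rewrite (nonadj_eq _ _ uw) (nonadj_eq _ _ vw).
  + by move=> _ [u ->]; exists u.
  + move=> u v; split=> [uv [_ [[w ->] wu wv]]|].
      by apply: nonadj_trans uv; [exact: nonadj_sym wu|].
    apply: contra_notP => uv; exists (nonadj u); split=> //; by exists u.
- move=> _ [u ->].
  have [[v [uv uv']]|single] := pselect (exists v, nonadj u v /\ u <> v).
    apply: (card_le_pair _ u v) => w uw.
    by have [|->|->] := third u v w uv uw; [|left|right].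
  apply: (card_le_pair _ u u) => w uw; left.
  by apply: contra_notP single => wu; exists w; split=> // /esym.
- move=> _ _ [u ->] [v ->] u1 v1.
  (* A singleton class belongs to a vertex adjacent to all others in the component. *)
  have univ x : nonadj x #= `I_1 ->
      forall w, conn (val x) w -> w <> val x -> H (val x) w.
    move=> x1 _ /connC[w <-]; apply: contra_notP => xw; congr val.
    exact: card_eq1_inj x1 _ _.
  have [uv|] := pselect (H (val u) (val v)); last exact: nonadj_eq.
  by congr nonadj; apply/val_inj/uniq_univ => //; exact: univ.
Qed.

End ComponentMultipartite.

Section Condensation.

Context {V : Type} {G : sgraph V}.
Implicit Types K L : critical_cliques G.

(** The edge between [u] and [v] puts each in the closed neighborhood of the other, so open
    neighborhoods need only agree off these two vertices. *)
Lemma homogeneous_sub u v :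
  (forall w, G u w -> w = v \/ G v w) -> (forall w, G v w -> w = u \/ G u w) ->
  G u v -> homogeneous G u v.
Proof.
move=> uv vu Guv; apply/seteqP; split=> w /= [->|].
- by right; exact: adj_sym.
- exact: uv.
- by right.
- exact: vu.
Qed.

Lemma homogeneous_adj {u v} : homogeneous G u v -> u = v \/ G u v.
Proof.
move=> uv; have : closed_nbhd G v u by rewrite -uv; left.
by case=> [|vu]; [left|right; exact: adj_sym].
Qed.

Lemma homogeneous_adjl {u u' v} :
  homogeneous G u u' -> G u v -> v = u' \/ G u' v.
Proof.
move=> uu' uv; have : closed_nbhd G u v by right.
by rewrite uu'.
Qed.

Lemma critical_clique_rep K : exists u, val K = [set w | homogeneous G w u].
Proof. exact: (set_valP K). Qed.

Lemma critical_clique_neq0 K : exists u, val K u.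
Proof. by have [u ->] := critical_clique_rep K; exists u. Qed.

Lemma critical_clique_cover u : exists K : critical_cliques G, val K u.
Proof.
have uG : [set w | homogeneous G w u] \in critical_cliques G.
  by rewrite inE; exists u.
by exists (exist _ [set w | homogeneous G w u] uG).
Qed.

Lemma critical_clique_eqP {K L u v} :
  val K u -> val L v -> homogeneous G u v <-> K = L.
Proof.
have [x Kx] := critical_clique_rep K; have [y Ly] := critical_clique_rep L.
rewrite Kx Ly /= => ux vy; split=> [uv|KL].
- by apply: val_inj; rewrite Kx Ly; congr mkset; apply/funext => w;
    rewrite /homogeneous -ux uv vy.
- have : val L u by rewrite -KL Kx.
  by rewrite Ly /homogeneous vy.
Qed.

(** Adjacency of classes can be tested on any representatives: the ends of an edge are replaced one
    at a time by homogeneous vertices. This fails only if an end lands on the other one, which would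
    force [K = L]. *)
Lemma condensation_adjP {K L u v} : val K u -> val L v ->
  condensation G K L <-> ~ homogeneous G u v /\ G u v.
Proof.
move=> Ku Lv; split=> [[KL [u' [v' [Ku' Lv' uv]]]]|[uv Guv]].
- have nh x y : val K x -> val L y -> ~ homogeneous G x y.
    by move=> Kx Ly /(critical_clique_eqP Kx Ly).
  split; first exact: nh.
  have hu : homogeneous G u' u by apply/critical_clique_eqP; eauto.
  have hv : homogeneous G v' v by apply/critical_clique_eqP; eauto.
  have [v'u|uv'] := homogeneous_adjl hu uv.
    by case: (nh _ _ Ku Lv'); rewrite v'u.
  have [uv2|] := homogeneous_adjl hv (adj_sym uv'); last exact: adj_sym.
  by case: (nh _ _ Ku Lv); rewrite uv2.
- split; last by exists u, v.
  by move=> /(critical_clique_eqP Ku Lv).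
Qed.

End Condensation.

Section NicheGraph.

Context {V : Type} {D : digraph V} (hD : bipartite_tournament D).
Context {G : sgraph V} (GE : forall u v, G u v <-> niche_graph D u v).

(** Stands in for lying in the same part, without naming a bipartition. It is not reflexive at a
    vertex without neighbors in [D]. *)
Definition linked u v := exists w, (D u w \/ D w u) /\ (D v w \/ D w v).

Definition opposite u v :=
  forall w, (D u w <-> D w v) /\ (D w u <-> D v w).

Lemma linked_sym {u v} : linked u v -> linked v u.
Proof. by move=> [w []]; exists w. Qed.

Lemma adj_linked {u v} : G u v -> linked u v.
Proof. by move=> /GE[_ [w [[]|[]]]]; exists w; tauto. Qed.

(** The common neighbor [x] forces [u] and [v] into the part opposite to its own, and in a complete
    bipartite graph the part determines the neighborhood. *)
Lemma linked_nbr {u v} w : linked u v -> D u w \/ D w u <-> D v w \/ D w v.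
Proof.
have [B [[X [Y [XY XY0 BE]]] [BD _]]] := hD.
move=> [x]; rewrite -!BD !BE.
have disj z : ~ (X z /\ Y z) by move=> XYz; have : set0 z by rewrite -XY0.
move: (disj u) (disj v) (disj w) (disj x); tauto.
Qed.

Lemma linked_trans {u v w} : linked u v -> linked v w -> linked u w.
Proof.
move=> uv [x [vx wx]]; exists x; split=> //.
exact/(linked_nbr _ uv).
Qed.

(** Each [w] is joined to both vertices or to neither; if to both, equal orientations would make [u]
    and [v] niche-adjacent. *)
Lemma nonadj_opposite u v : linked u v -> u <> v -> ~ G u v -> opposite u v.
Proof.
have [B [_ [_ Dasym]]] := hD.
move=> uv neq nadj w; have nbr := linked_nbr w uv.
have no_common : ~ ((D u w /\ D v w) \/ (D w u /\ D w v)).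
  by move=> uvw; apply: nadj; apply/GE; split=> //; exists w.
move: (Dasym u w) (Dasym v w); tauto.
Qed.

(** Reversing arcs twice makes [v] and [w] twins in [D]. Being linked excludes distinct twins
    without neighbors, which are not adjacent in [G]. *)
Lemma opposite_homogeneous u v w : linked v w ->
  opposite u v -> opposite u w -> homogeneous G v w.
Proof.
move=> vw uv uw.
have [->//|neq] := pselect (v = w).
have twin x : (D v x <-> D w x) /\ (D x v <-> D x w).
  by move: (uv x) (uw x); tauto.
apply: homogeneous_sub => [x /GE[vx [y vxy]]|x /GE[wx [y wxy]]|].
- have [->|xw] := pselect (x = w); [by left|right].
  by apply/GE; split; [exact: nesym|exists y; move: (twin y); tauto].
- have [->|xv] := pselect (x = v); [by left|right].
  by apply/GE; split; [exact: nesym|exists y; move: (twin y); tauto].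
- have [y vwy] := vw; apply/GE; split=> //; exists y.
  by move: (twin y); tauto.
Qed.

Lemma nonadj_homogeneous {u v w} : linked u v -> linked u w ->
  u <> v -> u <> w -> ~ G u v -> ~ G u w -> homogeneous G v w.
Proof.
move=> uv uw *; apply: (@opposite_homogeneous u); try exact: nonadj_opposite.
exact: linked_trans (linked_sym uv) uw.
Qed.

(** Links are composed along a path of classes through chosen representatives. The case [u = v] is
    kept apart because a vertex isolated in [D] is not linked to itself. *)
Lemma condensation_conn_linked {K L : critical_cliques G} {u v} :
  clos_refl_trans _ (condensation G) K L -> val K u -> val L v ->
  u = v \/ linked u v.
Proof.
move=> KL; elim: KL u v => {K L} [K L KL|K|K M L _ KM _ ML] u v.
- move=> Ku Lv; right; apply: adj_linked.
  by have [] := (condensation_adjP Ku Lv).1 KL.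
- move=> Ku Kv; have [|/adj_linked] : u = v \/ G u v; [|by left|by right].
  by apply: homogeneous_adj; apply/critical_clique_eqP; eauto.
- move=> Ku Lv; have [m Mm] := critical_clique_neq0 M.
  have [->|um] := KM u m Ku Mm; first exact: ML.
  have [<-|mv] := ML m v Mm Lv; first by right.
  by right; exact: linked_trans um mv.
Qed.

End NicheGraph.

Theorem theorem3p11 (V : Type) (G : sgraph V) (hG : niche_realizable G)
    (C : set (critical_cliques G)) (hC : components (condensation G) C) :
  exists P : set (set C),
    [/\ complete_multipartite (induced (condensation G) C) P,
        forall A, P A -> A #<= `I_2 &
        forall A B, P A -> P B -> A #= `I_1 -> B #= `I_1 -> A = B].
Proof.
have [D [hD GE]] := hG.
have neq (K L : critical_cliques G) u v :
    val K u -> val L v -> K <> L -> ~ homogeneous G u v /\ u <> v.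
  move=> Ku Lv KL; have nh : ~ homogeneous G u v.
    by move=> /(critical_clique_eqP Ku Lv).
  by split=> // uv; apply: nh; rewrite uv.
apply: component_multipartite => //.
- move=> K L M KL KM nKL nKM aKL aKM.
  have [u Ku] := critical_clique_neq0 K.
  have [v Lv] := critical_clique_neq0 L; have [w Mw] := critical_clique_neq0 M.
  have [huv uv] := neq _ _ _ _ Ku Lv nKL.
  have [huw uw] := neq _ _ _ _ Ku Mw nKM.
  have [//|luv] := condensation_conn_linked hD GE KL Ku Lv.
  have [//|luw] := condensation_conn_linked hD GE KM Ku Mw.
  apply/(critical_clique_eqP Lv Mw)/(nonadj_homogeneous hD GE luv luw) => // g.
  + by apply: aKL; apply/(condensation_adjP Ku Lv).
  + by apply: aKM; apply/(condensation_adjP Ku Mw).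
- move=> K L KL univK univL; have [u Ku] := critical_clique_neq0 K.
  have [v Lv] := critical_clique_neq0 L.
  (* One half of the neighborhood comparison, applied below in both directions. A neighbor [w] of
     [u1] either shares the class of [v1] or has a class that [L1] reaches through [K1], so
     universality of [L1] applies. *)
  have sub K1 L1 u1 v1 : val K1 u1 -> val L1 v1 -> condensation G K1 L1 ->
      (forall M, clos_refl_trans _ (condensation G) L1 M -> M <> L1 ->
         condensation G L1 M) ->
      forall w, G u1 w -> w = v1 \/ G v1 w.
    move=> K1u L1v K1L1 univ w u1w.
    have [M Mw] := @critical_clique_cover _ G w.
    have [ML|ML] := pselect (M = L1).
      have [->|] := homogeneous_adj ((critical_clique_eqP L1v Mw).2 (esym ML));
        by [left|right].
    right; suff /(condensation_adjP L1v Mw)[] : condensation G L1 M by [].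
    apply: univ => //; apply: (rt_trans _ _ _ K1).
      by apply: rt_step; exact: adj_sym.
    have [<-|KM] := pselect (K1 = M); first exact: rt_refl.
    by apply: rt_step; split=> //; exists u1, w.
  apply/(critical_clique_eqP Ku Lv)/homogeneous_sub.
  + exact: sub KL univL.
  + exact: sub (adj_sym KL) univK.
  + by have [] := (condensation_adjP Ku Lv).1 KL.
Qed.
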